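(* Let $\lambda$ be an infinite cardinal such that $\lambda^{\aleph_0}=\lambda$. Then there exists a Hausdorff topological space $S$ such that: (1) $|S|=\lambda$; (2) $S$ is dense in itself; (3) each subspace of $S$ of cardinality less than $\operatorname{cf}(\lambda)$ (the cofinality of $\lambda$) is scattered; and (4) $S$ is sequentially compact.
   Context: A topological space is dense in itself if it has no isolated points. A topological space is scattered if each of its nonempty subsets $A$ has an isolated point, i.e. a point isolated in the subspace topology of $A$. A space is sequentially compact if every sequence in it has a convergent subsequence. *)

(* Defs.v *)
From mathcomp Require Import all_boot all_order all_algebra.
From mathcomp Require Import all_classical topology.
From mathcomp Require Import wochoice.

Set Implicit Arguments.
Unset Strict Implicit.
Unset Printing Implicit Defensive.

Local Open Scope classical_set_scope.
Local Open Scope card_scope.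

Definition card_lt {T U : Type} (A : set T) (B : set U) : Prop :=
  A #<= B /\ ~ (B #<= A).

(* A cardinal is an initial ordinal: a type L with a (reflexive) well-order le
   all of whose proper initial segments have cardinality less than that of L. *)
Definition is_cardinal (L : Type) (le : rel L) : Prop :=
  well_order le /\
  forall x : L, card_lt [set y | le y x /\ y <> x] [set: L].

Definition cofinal {L : Type} (le : rel L) (C : set L) : Prop :=
  forall x : L, exists2 y, C y & le x y.

(* The cardinality of C is the cofinality of (L, le). Such a C always exists
   when le is total, because cardinals are well-ordered, and its cardinality is
   unique. *)
Definition realizes_cf {L : Type} (le : rel L) (C : set L) : Prop :=
  cofinal le C /\ forall D : set L, cofinal le D -> C #<= D.

Definition card_lt_cf {T L : Type} (A : set T) (le : rel L) : Prop :=
  exists2 C : set L, realizes_cf le C & card_lt A C.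

Definition dense_in_itself (T : topologicalType) : Prop :=
  forall x : T, ~ isolated [set: T] x.

Definition scattered (T : topologicalType) : Prop :=
  forall A : set T, A !=set0 -> exists x, isolated A x.

Definition sequentially_compact (T : topologicalType) : Prop :=
  forall u : nat -> T, exists f : nat -> nat,
    {homo f : m n / (m < n)%N} /\ exists l : T, (u \o f) @ \oo --> l.

(* Main.v *)
Require Import Defs.
From HB Require Import structures.
From mathcomp Require Import all_boot all_order all_algebra.
From mathcomp Require Import all_classical topology.
From mathcomp Require Import wochoice.

(** The space is the cardinal [L] itself, with a topology coarse enough to have
    no isolated point and fine enough to be Hausdorff.

    In the order topology of [L] initial segments are open, and a sequence has a
    convergent subsequence because it has a nondecreasing one, which converges
    to its supremum. This supremum exists since the cofinality of [L] is
    uncountable ([sequence_bounded]): this is Koenig's theorem, by a diagonal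
    argument from the equality of the cardinals [L ^ nat] and [L]. The
    topology is Hausdorff and makes every successor isolated. A coarser one
    repairs the last point: distribute the successors among all points of [L],
    so that each point [x] receives a cofinal set of children, all above [x]
    ([children_cofinal]), and let [U] be open when it is order-open and
    contains, with each of its points, all the children of this point beyond
    some bound. Now no point is isolated, and the sequences that converged
    still do.

    An order-open set [V] becomes open when the children beyond [b] of its
    points are added to it, then the children beyond [b] of these, and so on
    ([grow b V]): the points added are successors, so that order-openness is
    preserved. As the bound [b] is free, two facts follow. If [V] and [V'] are
    disjoint and below [b], then [grow b V] and [grow b V'] are disjoint,
    because a point has at most one parent ([grow_disjoint]): the space is
    Hausdorff. And if [b] bounds a set [A], then the least point [x] of any
    nonempty part of [A] is isolated in this part, as [grow b] of the initial
    segment ending at [x] adds no point of [A]: bounded subspaces are scattered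
    ([bounded_scattered]), in particular those of cardinality less than the
    cofinality.

    Order-openness is only ever used through suprema of nondecreasing
    sequences, and [sup_open] retains just this. *)

Set Implicit Arguments.
Unset Strict Implicit.
Unset Printing Implicit Defensive.

Local Open Scope classical_set_scope.
Local Open Scope card_scope.

(** * Well-orders *)

Section WellOrder.
Context (L : Type) (le : rel L) (le_wo : well_order le).

Local Notation "x \prec y" := (~~ le y x) (at level 70).

Lemma wo_min (P : set L) :
  P !=set0 -> exists2 x, P x & forall y, P y -> le x y.
Proof.
move=> [x Px]; have [|z [[/asboolP Pz zmin] _]] := le_wo (A := fun x => `[<P x>]).
  by exists x; apply/asboolP.
by exists z => // y Py; apply: zmin; apply/asboolP.
Qed.

Lemma wo_refl x : le x x.
Proof. by have [|y -> /(_ x)->] := @wo_min [set x]; first by exists x. Qed.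

Lemma wo_total x y : le x y || le y x.
Proof.
have [|z [] -> zmin] := @wo_min [set x; y]; first by exists x; left.
  by rewrite zmin//; right.
by rewrite orbC zmin//; left.
Qed.

(** Antisymmetry is the uniqueness of the minimum of a pair. *)
Lemma wo_anti x y : le x y -> le y x -> x = y.
Proof.
move=> xy yx; have [|z [_ zuniq]] := le_wo (A := fun z => `[<z = x \/ z = y>]).
  by exists x; apply/asboolP; left.
have zx : z = x.
  apply: zuniq; split=> [|w /asboolP[]->//]; last exact: wo_refl.
  by apply/asboolP; left.
rewrite -zx; apply: zuniq; split=> [|w /asboolP[]->//]; last exact: wo_refl.
by apply/asboolP; right.
Qed.

Lemma wo_trans x y z : le x y -> le y z -> le x z.
Proof.
move=> xy yz; have [|w ww wmin] := @wo_min [set x; y; z].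
  by exists x; left; left.
case: ww wmin => [[]|] -> wmin; first by apply: wmin; right.
  have yx : le y x by apply: wmin; left; left.
  by rewrite (wo_anti xy yx).
have zy : le z y by apply: wmin; left; right.
by rewrite -(wo_anti yz zy).
Qed.

Lemma wo_ltW x y : x \prec y -> le x y.
Proof. by case/orP: (wo_total x y) => // ->. Qed.

Lemma wo_lt_le_trans x y z : x \prec y -> le y z -> x \prec z.
Proof. by move=> xy yz; apply: contra xy; exact: wo_trans. Qed.

Lemma wo_le_lt_trans x y z : le x y -> y \prec z -> x \prec z.
Proof. by move=> xy; apply: contra => zx; exact: wo_trans zx xy. Qed.

Lemma wo_max x y : exists2 z, le x z & le y z.
Proof.
by case/orP: (wo_total x y) => ?; [exists y|exists x]; rewrite // wo_refl.
Qed.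

(** The indices are chosen greedily: each next term is the least one among all
    the later terms. *)
Lemma nondecreasing_subsequence (u : nat -> L) :
  exists2 f : nat -> nat, {homo f : m n / (m < n)%N} &
    {homo u \o f : m n / (m <= n)%N >-> le m n}.
Proof.
have /choice[g gP] m : exists k,
    (m < k)%N /\ forall i, (m < i)%N -> le (u k) (u i).
  have [|_ [k mk <-] kmin] := @wo_min (u @` [set k | (m < k)%N]).
    by exists (u m.+1), m.+1 => /=.
  by exists k; split=> // i mi; apply: kmin; exists i.
have gt_g m : (m < g m)%N := (gP m).1.
pose f n := iter n.+1 g 0%N.
exists f; first by apply: homo_ltn => [? ? ?|n]; [exact: ltn_trans|exact: gt_g].
apply: homo_leq => [x|y x z|n]; [exact: wo_refl|exact: wo_trans|].
by apply: (gP _).2; rewrite (ltn_trans (gt_g _) (gt_g _)).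
Qed.

Definition is_sup (u : nat -> L) x :=
  (forall n, le (u n) x) /\ forall b, (forall n, le (u n) b) -> le x b.

Lemma bounded_has_sup (u : nat -> L) b :
  (forall n, le (u n) b) -> exists x, is_sup u x.
Proof.
move=> ub; have [|x ux xmin] := @wo_min [set x | forall n, le (u n) x].
  by exists b.
by exists x.
Qed.

Definition is_succ w y := w \prec y /\ forall z, w \prec z -> le y z.

Lemma has_succ w z : w \prec z -> exists y, is_succ w y.
Proof.
move=> wz; have [|y wy ymin] := @wo_min [set z | w \prec z]; first by exists z.
by exists y.
Qed.

Lemma succ_inj w w' y : is_succ w y -> is_succ w' y -> w = w'.
Proof.
move=> [wy ymin] [w'y ymin']; apply: wo_anti; apply/negP => /negP.
  by move=> /ymin'; rewrite (negbTE wy).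
by move=> /ymin; rewrite (negbTE w'y).
Qed.

(** A supremum that is not attained is a limit point of the order. *)
Lemma succ_sup_attained (u : nat -> L) w y :
    {homo u : m n / (m <= n)%N >-> le m n} -> is_succ w y -> is_sup u y ->
  exists N, forall n, (N <= n)%N -> u n = y.
Proof.
move=> u_nd [wy ymin] [uy y_least].
have [N wuN] : exists N, w \prec u N.
  apply: contrapT => /forallNP uw; apply/negP: wy; rewrite negbK.
  apply: y_least => n.
  by apply/negPn/negP => /uw.
exists N => n Nn; apply: wo_anti; first exact: uy.
exact: wo_trans (ymin _ wuN) (u_nd _ _ Nn).
Qed.

End WellOrder.

(** * The topology on a well-ordered set with tags *)

Section TaggedOrder.
Context (L : Type) (le : rel L) (le_wo : well_order le) (tag : L -> L).

Local Notation "x \prec y" := (~~ le y x) (at level 70).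

(** Tags are read at predecessors, so that only successors are children (adding
    them to a set costs nothing for the order) although all points are tagged:
    a cofinal set of points with tag [x] then gives a cofinal set of children
    of [x]. *)
Definition child x y := [/\ x \prec y & exists2 w, is_succ le w y & tag w = x].

Lemma parent_unique x x' y : child x y -> child x' y -> x = x'.
Proof.
by move=> [_ [w wy <-]] [_ [w' w'y <-]]; rewrite (succ_inj le_wo wy w'y).
Qed.

(** At points of countable cofinality this is openness in the order topology; a
    point of uncountable cofinality is not the supremum of a sequence of smaller
    points, hence is subject to no condition. *)
Definition sup_open (U : set L) := forall (u : nat -> L) x,
  {homo u : m n / (m <= n)%N >-> le m n} -> is_sup le u x -> U x ->
  exists N, forall n, (N <= n)%N -> U (u n).

Definition child_open (U : set L) := forall x, U x ->
  exists b, forall y, child x y -> b \prec y -> U y.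

Definition tagged_open (U : set L) := sup_open U /\ child_open U.

Lemma sup_openI U V : sup_open U -> sup_open V -> sup_open (U `&` V).
Proof.
move=> oU oV u x u_nd ux [Ux Vx].
have [M UM] := oU u x u_nd ux Ux; have [N VN] := oV u x u_nd ux Vx.
by exists (maxn M N) => n; rewrite geq_max => /andP[/UM ? /VN].
Qed.

Lemma tagged_openT : tagged_open setT.
Proof. by split=> [? ? _ _ _|x _]; [exists 0%N|exists x]. Qed.

Lemma tagged_openI : setI_closed tagged_open.
Proof.
move=> A B [As Ac] [Bs Bc]; split=> [|x [Ax Bx]]; first exact: sup_openI.
have [a Aa] := Ac x Ax; have [b Bb] := Bc x Bx.
have [c ac bc] := wo_max le_wo a b.
by exists c => y xy cy; split; [apply: Aa|apply: Bb] => //;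
  exact: wo_le_lt_trans cy.
Qed.

Lemma tagged_open_bigU (I : Type) (F : I -> set L) :
  (forall i, tagged_open (F i)) -> tagged_open (\bigcup_i F i).
Proof.
move=> oF; split=> [u x u_nd ux [i _ Fx]|x [i _ Fx]].
  by have [N FN] := (oF i).1 u x u_nd ux Fx; exists N => n /FN; exists i.
by have [b Fb] := (oF i).2 x Fx; exists b => y xy /(Fb y xy); exists i.
Qed.

(** The well-order is a parameter because it makes the family of open sets
    stable under intersection. *)
Definition tagged_space of well_order le & (L -> L) : Type := L.

(** The descendants of [V], along the children beyond [b]. *)
Inductive grow (b : L) (V : set L) : set L :=
| grow_seed x : V x -> grow b V x
| grow_child x y : grow b V x -> child x y -> b \prec y -> grow b V y.

Lemma grow_above b V z : grow b V z -> V z \/ b \prec z.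
Proof. by case=> [x ?|x y _ _ ?]; [left|right]. Qed.

(** The points added to [V] are successors: a nondecreasing sequence reaches
    them if they are its supremum. *)
Lemma tagged_open_grow b V : sup_open V -> tagged_open (grow b V).
Proof.
move=> oV; split=> [u z u_nd uz Gz|z Gz]; last first.
  by exists b => y zy /(grow_child Gz zy).
case: Gz uz => {z} [z Vz|x z Gx xz bz] uz.
  by have [N VN] := oV u z u_nd uz Vz; exists N => n /VN; exact: grow_seed.
have [_ [w wz _]] := xz.
have [N uN] := succ_sup_attained le_wo u_nd wz uz.
by exists N => n /uN ->; exact: grow_child xz bz.
Qed.

(** Parents are unique, so a common point reached as a child from both sides has
    its parent in both sets; going up the ancestors ends at a point of [V] or
    [V'], which is below [b], thus not beyond [b], thus in both [V] and [V']. *)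
Lemma grow_disjoint b (V V' : set L) :
    (forall z, V z -> le z b) -> (forall z, V' z -> le z b) ->
    (forall z, V z -> ~ V' z) ->
  forall z, grow b V z -> ~ grow b V' z.
Proof.
move=> Vb V'b VV' z; elim=> [{}z Vz /grow_above[/(VV' _ Vz)//|]|].
  by rewrite Vb.
move=> x y _ IH xy b_y Gy.
case: Gy xy b_y => {}y => [V'y _|x' Gx' x'y _ xy _]; first by rewrite V'b.
by move: Gx'; rewrite -(parent_unique xy x'y).
Qed.

Lemma sup_open_initial x : sup_open [set z | le z x].
Proof.
move=> u z _ [uz _] zx; exists 0%N => n _ /=.
exact: wo_trans (uz n) zx.
Qed.

Lemma sup_open_final x : sup_open [set z | x \prec z].
Proof.
move=> u z u_nd [_ z_least] xz; have [N xuN] : exists N, x \prec u N.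
  apply: contrapT => /forallNP ux; apply/negP: xz; rewrite negbK.
  apply: z_least => n.
  by apply/negPn/negP => /ux.
exists N => n Nn /=; exact: wo_lt_le_trans xuN (u_nd _ _ Nn).
Qed.

End TaggedOrder.

HB.instance Definition _ (L : Type) (le : rel L) (le_wo : well_order le)
  (tag : L -> L) := gen_eqMixin (tagged_space le_wo tag).
HB.instance Definition _ (L : Type) (le : rel L) (le_wo : well_order le)
  (tag : L -> L) := gen_choiceMixin (tagged_space le_wo tag).
HB.instance Definition _ (L : Type) (le : rel L) (le_wo : well_order le)
  (tag : L -> L) := isOpenTopological.Build (tagged_space le_wo tag)
    (tagged_openT le tag) (@tagged_openI L le le_wo tag)
    (@tagged_open_bigU L le tag).

Section TaggedSpace.
Context (L : Type) (le : rel L) (le_wo : well_order le) (tag : L -> L).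

Local Notation "x \prec y" := (~~ le y x) (at level 70).
Local Notation S := (tagged_space le_wo tag).

(** For [x] below [y], grow beyond [y] the points up to [x] and the points
    between [x] excluded and [y]. *)
Lemma tagged_space_hausdorff : hausdorff_space S.
Proof.
rewrite open_hausdorff.
have sep (x y : L) : x \prec y -> exists AB : set S * set S,
    [/\ AB.1 x, AB.2 y, open AB.1, open AB.2 & AB.1 `&` AB.2 = set0].
  move=> xy; exists (grow le tag y [set z | le z x],
    grow le tag y ([set z | x \prec z] `&` [set z | le z y])) => /=; split.
  - by apply: grow_seed; exact: wo_refl.
  - by apply: grow_seed; split => //; exact: wo_refl.
  - by apply: tagged_open_grow => //; exact: sup_open_initial.
  - apply: tagged_open_grow => //; apply: sup_openI.
      exact: sup_open_final.
    exact: sup_open_initial.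
  - rewrite -subset0 => z [Gz G'z]; apply: (grow_disjoint le_wo) Gz G'z.
    + by move=> w wx; exact: wo_trans wx (wo_ltW le_wo xy).
    + by move=> w [].
    + by move=> w /= wx []; rewrite wx.
move=> x y /eqP xy; have [yx|/negbTE/negbT/sep] := boolP (le y x); last first.
  move=> [[A B] /= [Ax By oA oB AB0]].
  by exists (A, B); [rewrite !inE|split=> //=; exact/eqP].
have [|[A B] /= [Ay Bx oA oB AB0]] := sep y x.
  by apply/negP => /(wo_anti le_wo)/(_ yx).
by exists (B, A); [rewrite !inE|split=> //=; rewrite setIC; exact/eqP].
Qed.

Lemma tagged_space_dense :
    (forall x b, exists2 y, child le tag x y & b \prec y) -> dense_in_itself S.
Proof.
move=> children x [_ [V]]; rewrite nbhsE => -[U [[_ oU] Ux] UV] Vx.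
have [b Ub] := oU x Ux; have [y xy b_y] := children x b.
have : (V `&` setT) y by split=> //; apply/UV/Ub.
by rewrite Vx => /= yx; have [+ _] := xy; rewrite yx wo_refl.
Qed.

(** The least point [x] of a part of [A] is isolated in it: the initial segment
    ending at [x] meets that part in [x] alone, and growing it beyond [b] meets
    no further point of [A]. *)
Lemma bounded_scattered (A : set S) b :
  (forall x, A x -> le x b) -> scattered (set_type A).
Proof.
move=> Ab B [x0 Bx0].
have [|_ [x Bx <-] xmin] := @wo_min L le le_wo (set_val @` B).
  by exists (set_val x0), x0.
exists x; split; first exact/mem_set.
pose U := grow le tag b [set z | le z (set_val x)] : set S.
exists (set_val @^-1` U : set (set_type A)).
  apply: open_nbhs_nbhs; split.
    exists U => //; apply: tagged_open_grow => //; exact: sup_open_initial.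
  by apply: grow_seed; exact: wo_refl.
apply/seteqP; split=> [y [Uy By]|_ ->]; last first.
  by split=> //; apply: grow_seed; exact: wo_refl.
have [yx|] := grow_above (Uy : grow le tag b _ (set_val y)).
  by apply: val_inj; apply: (wo_anti le_wo yx); apply: xmin; exists y.
by rewrite Ab//; exact/set_mem/valP.
Qed.

Lemma tagged_space_sequentially_compact :
    (forall u : nat -> L, exists b, forall n, le (u n) b) ->
  sequentially_compact S.
Proof.
move=> bounded u; have [f f_incr uf_nd] := nondecreasing_subsequence le_wo u.
have [b ufb] := bounded (u \o f); have [l ufl] := bounded_has_sup le_wo ufb.
exists f; split=> //; exists l => V; rewrite nbhsE => -[U [[oU _] Ul] UV].
have [N UN] := oU (u \o f) l uf_nd ufl Ul.
by exists N => // n /= Nn; apply/UV/UN.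
Qed.

End TaggedSpace.

(** * Combinatorics of the cardinal *)

Lemma card_le_onto (T U : Type) (A : set T) :
    [set: U] #<= A -> [set: U] !=set0 ->
  exists f : T -> U, forall y, exists2 x, A x & f x = y.
Proof.
move=> /pfcard_geP[->[]//|[f] _]; exists f => y.
by have [x Ax <-] := @surj _ _ _ _ f y I; exists x.
Qed.

Section Cardinal.
Context (L : Type) (le : rel L) (L_cardinal : is_cardinal le).
Let le_wo : well_order le := L_cardinal.1.

Local Notation "x \prec y" := (~~ le y x) (at level 70).

(** What being an initial ordinal is used for: a segment of [L] has too few
    points to be mapped onto [L]. *)
Lemma segment_not_onto b (f : L -> L) : exists y, forall x, x \prec b -> f x <> y.
Proof.
have [_ +] := L_cardinal.2 b; apply: contra_notP => /forallNP onto.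
set I := [set y | _].
apply: (card_le_trans _ (card_image_le f I)).
apply: subset_card_le => y _.
have /existsNP[x /not_implyP[xb /notP fxy]] := onto y.
exists x => //; split; first exact: wo_ltW.
by move=> xeb; rewrite xeb wo_refl in xb.
Qed.

Context (F : L -> nat -> L) (F_onto : forall g, exists w, F w = g).

(** If [u] were cofinal, a sequence whose [n]-th term avoids the [n]-th terms of
    all [F w] with [w] below [u n] would not be any [F w]. *)
Lemma sequence_bounded (u : nat -> L) : exists b, forall n, le (u n) b.
Proof.
apply: contrapT => /forallNP unbounded.
have /choice[g gP] n := segment_not_onto (u n) (F^~ n).
have [w Fw] := F_onto g; have /existsNP[n /negP wun] := unbounded w.
by apply: (gP n w wun); rewrite Fw.
Qed.

(** The sequences with first term [x] are as many as the points of [L], which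
    are more than the points below [b]. *)
Lemma fiber_cofinal x b : exists2 w, F w 0%N = x & le b w.
Proof.
have [y yP] := segment_not_onto b (fun w => F w 1%N).
have [w Fw] := F_onto (fun n => if n is 0 then x else y).
exists w; first by rewrite Fw.
by apply/negPn/negP => /yP; rewrite Fw.
Qed.

Lemma no_greatest (L_infinite : infinite_set [set: L]) b : exists w, b \prec w.
Proof.
have [z [_ zb]] : ([set: L] `\` [set b]) !=set0.
  exact/infinite_setN0/infinite_setD.
(* The fibers of [b] and of [z] both reach [b], in two distinct points. *)
have [w Fw bw] := fiber_cofinal b b; have [v Fv bv] := fiber_cofinal z b.
have [wb|] := boolP (le w b); last by exists w.
have [vb|] := boolP (le v b); last by exists v.
have vw : v = w by rewrite -(wo_anti le_wo bw wb) -(wo_anti le_wo bv vb).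
by case: zb; rewrite /= -Fv vw.
Qed.

Lemma children_cofinal (L_infinite : infinite_set [set: L]) x b :
  exists2 y, child le (F^~ 0%N) x y & b \prec y.
Proof.
have [c xc bc] := wo_max le_wo x b; have [w Fw cw] := fiber_cofinal x c.
have [z wz] := no_greatest L_infinite w; have [y wy] := has_succ le_wo wz.
have cy : c \prec y by exact: (wo_le_lt_trans le_wo cw wy.1).
exists y; last exact: wo_le_lt_trans cy.
by split; [exact: wo_le_lt_trans cy|exists w].
Qed.

End Cardinal.

Lemma card_lt_cf_bounded (L : Type) (le : rel L) (le_wo : well_order le)
    (A : set L) :
  card_lt_cf A le -> exists b, forall x, A x -> le x b.
Proof.
move=> [C [_ C_least] [_ +]]; apply: contra_notP => /forallNP unbounded.
apply: C_least => b.
have /existsNP[x /not_implyP[Ax /negP bx]] := unbounded b.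
by exists x; [|exact: wo_ltW].
Qed.

Theorem theorem2 (L : Type) (le : rel L)
    (L_cardinal : is_cardinal le)
    (L_infinite : infinite_set [set: L])
    (L_exp : [set: nat -> L] #= [set: L]) :
  exists S : topologicalType,
    hausdorff_space S /\
    [set: S] #= [set: L] /\
    dense_in_itself S /\
    (forall A : set S, card_lt_cf A le -> scattered (set_type A)) /\
    sequentially_compact S.
Proof.
have [x0 _] := infinite_setN0 L_infinite.
have [F F_onto'] : exists F : L -> nat -> L, forall g, exists2 w, setT w & F w = g.
  apply: card_le_onto; first by rewrite (card_le_eql L_exp).
  by exists (fun=> x0).
have F_onto g : exists w, F w = g by have [w _ <-] := F_onto' g; exists w.
exists (tagged_space L_cardinal.1 (F^~ 0%N)); split; [|split; [|split; [|split]]].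
- exact: tagged_space_hausdorff.
- exact: card_eqxx.
- by apply: tagged_space_dense => x b; exact: children_cofinal.
- move=> A /(card_lt_cf_bounded L_cardinal.1)[b Ab].
  exact: bounded_scattered Ab.
- by apply: tagged_space_sequentially_compact => u; exact: sequence_bounded.
Qed.
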